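(* Let $\alpha,\beta,\gamma>0$ satisfy $\gamma(\beta-1)>1$ and consider on $\mathbb{R}^2_+=[0,\infty)^2$ the system $$U'=\alpha U(\gamma-U)-\frac{UV}{1+U},\qquad V'=-V+\beta\frac{UV}{1+U}.$$ This system admits a unique heteroclinic orbit $\{(U(t),V(t)):t\in\mathbb{R}\}$ joining $(\gamma,0)$ to the boundary of the interior attractor $\mathcal{A}_{\mathrm{Int}(\mathbb{R}^2_+)}$. The global attractor $\mathcal{A}_{\mathbb{R}^2_+}$ is composed of three disjoint parts: $$\mathcal{A}_{\mathbb{R}^2_+}=\big([0,\gamma]\times\{0\}\big)\ \cup\ \{(U(t),V(t)):t\in\mathbb{R}\}\ \cup\ \mathcal{A}_{\mathrm{Int}(\mathbb{R}^2_+)}.$$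
   Context: $\mathrm{Int}(\mathbb{R}^2_+)=\{(U,V):U>0,V>0\}$; both $\mathbb{R}^2_+$ and $\mathrm{Int}(\mathbb{R}^2_+)$ are positively invariant under the semiflow generated by the system. A global attractor of the semiflow restricted to a positively invariant set $S$ is a compact connected invariant subset of $S$ which attracts every compact subset of $S$. $\mathcal{A}_{\mathbb{R}^2_+}$ and $\mathcal{A}_{\mathrm{Int}(\mathbb{R}^2_+)}$ (the ''interior attractor'') denote the global attractors of the semiflow restricted to $\mathbb{R}^2_+$ and to $\mathrm{Int}(\mathbb{R}^2_+)$ respectively; both exist. A heteroclinic orbit joining $(\gamma,0)$ to (the boundary of) the interior attractor is the orbit of a complete solution in $\mathrm{Int}(\mathbb{R}^2_+)$, not contained in the interior attractor, which converges to $(\gamma,0)$ as $t\to-\infty$ and whose $\omega$-limit set is contained in (the boundary of) the interior attractor. Uniqueness is as an orbit, i.e. up to time translation of the solution. *)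

(* Defs.v *)
From HB Require Import structures.
From mathcomp Require Import all_boot all_order all_algebra.
From mathcomp Require Import all_classical all_reals all_analysis.

Set Implicit Arguments.
Unset Strict Implicit.
Unset Printing Implicit Defensive.

Import Order.TTheory GRing.Theory Num.Theory.
Import numFieldNormedType.Exports.

Local Open Scope classical_set_scope.
Local Open Scope ring_scope.

Definition boundary (T : topologicalType) (A : set T) : set T :=
  closure A `\` interior A.

Section Semiflow.
Context {R : realType} {T : pseudoMetricType R}.
Implicit Types (phi : R -> T -> T) (S A K : set T) (u : R -> T).

(* Time is a real number; only the values phi t x with 0 <= t and x in S are
   constrained, so phi represents a map [0, +oo) x S -> S. *)
Record is_semiflow S phi : Prop := IsSemiflow {
  semiflow_stable : forall t x, 0 <= t -> S x -> S (phi t x) ;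
  semiflow0 : forall x, S x -> phi 0 x = x ;
  semiflowD : forall s t x, 0 <= s -> 0 <= t -> S x ->
    phi (s + t) x = phi s (phi t x) ;
  semiflow_continuous :
    {within [set p : R * T | 0 <= p.1 /\ S p.2],
      continuous (fun p : R * T => phi p.1 p.2)}
}.

Definition invariant phi A : Prop := forall t, 0 <= t -> phi t @` A = A.

Definition attracts phi A K : Prop :=
  forall e : R, 0 < e -> exists T0 : R, 0 <= T0 /\
    forall t x, T0 <= t -> K x -> exists2 a, A a & ball a e (phi t x).

Definition global_attractor phi S A : Prop :=
  [/\ A `<=` S, compact A, connected A, invariant phi A
    & forall K, K `<=` S -> compact K -> attracts phi A K].

Definition omega_limit u : set T := cluster (u t @[t --> +oo]).

End Semiflow.

Section PredatorPrey.
Context {R : realType}.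
Implicit Types (alpha beta gamma t : R) (x : R * R) (u : R -> R * R).

Definition quadrant : set (R * R) := [set x | 0 <= x.1 /\ 0 <= x.2].

Definition int_quadrant : set (R * R) := [set x | 0 < x.1 /\ 0 < x.2].

Definition prey_rate alpha gamma x : R :=
  alpha * x.1 * (gamma - x.1) - x.1 * x.2 / (1 + x.1).

Definition predator_rate beta x : R :=
  - x.2 + beta * (x.1 * x.2 / (1 + x.1)).

Definition solves_at alpha beta gamma u t : Prop :=
  is_derive t 1 (fun s => (u s).1) (prey_rate alpha gamma (u t)) /\
  is_derive t 1 (fun s => (u s).2) (predator_rate beta (u t)).

(* phi t x is unconstrained for t < 0, so the equations are imposed at t > 0
   only; continuity of phi determines the trajectory at t = 0. *)
Definition semiflow_of_system alpha beta gamma (phi : R -> R * R -> R * R) :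
    Prop :=
  is_semiflow quadrant phi /\
  forall x, quadrant x ->
    forall t, 0 < t -> solves_at alpha beta gamma (fun s => phi s x) t.

(* u parametrizes a heteroclinic orbit from the equilibrium p to the subset B
   of the interior attractor A. *)
Definition heteroclinic alpha beta gamma (p : R * R) (A B : set (R * R)) u :
    Prop :=
  [/\ forall t, solves_at alpha beta gamma u t,
      forall t, int_quadrant (u t),
      ~ (range u `<=` A),
      u t @[t --> -oo] --> p
    & omega_limit u `<=` B].

End PredatorPrey.

(* Main.v *)
Require Import Defs.
From mathcomp Require Import all_boot all_order all_algebra.
From mathcomp Require Import all_classical all_reals all_analysis.
From mathcomp Require Import ring lra.

Import Order.TTheory GRing.Theory Num.Theory.
Import numFieldNormedType.Exports.

Local Open Scope classical_set_scope.
Local Open Scope ring_scope.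

(** The coordinate axes are invariant and the flow on the prey axis is logistic,
    so everything hinges on complete bounded solutions in the open quadrant.
    Three facts carry the proof.

    _Every such solution outside the interior attractor starts at_ [(gamma, 0)]
    ([connecting_orbit]).  The interior attractor attracts compact subsets of
    the open quadrant uniformly, so a solution that is not in it must leave
    every such compact set as time goes to minus infinity
    ([leaves_compacts_backward]): being bounded, it approaches the axes.  Scarce
    prey makes the predator decay, hence grow backward, against boundedness; so
    it is the predator that vanishes ([predator_vanishes_backward]).  With a
    negligible predator the prey grows below [gamma]; if it stayed below, it
    would be scarce in the remote past and the predator would again blow up
    backward ([prey_recovers_backward]).

    _At most one orbit leaves_ [(gamma, 0)] ([emanating_solution_unique]).  The
    point is a saddle, by the hypothesis [1 < gamma * (beta - 1)].  For two
    solutions near it, with differences [x] of prey and [y] of predator, the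
    quadratic form [x ^ 2 - k * y ^ 2] is nonincreasing for a large [k], and it
    tends to [0] at minus infinity, so [x ^ 2 <= k * y ^ 2] ([unstable_cone]).
    Translate one solution in time so that the predators agree at one instant:
    the prey then agree as well, and the two solutions are equal.

    _Some orbit leaves_ ([attractor_neq_axis_interior]).  The attractor contains
    the compact set [[0, gamma] x {0}], on which every time map of the flow is
    onto by the intermediate value theorem, and it contains the interior
    attractor.  It is connected, and these two nonempty closed sets are
    disjoint, so it has a point in neither.

    The orbit through that point is the heteroclinic orbit, and by uniqueness
    every other point of the attractor outside the two sets lies on it.  It
    misses the interior attractor by backward uniqueness of solutions, which
    forces its limit set, a part of the interior attractor, into the
    boundary. *)

(** * Differential inequalities on the line *)

Section Calculus.
Context {R : realType}.
Implicit Types (f D h : R -> R) (a b c k L M t : R).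

Lemma is_derive_within_continuous f (f' : R -> R) a b :
  (forall t, is_derive t 1 f (f' t)) -> {within `[a, b], continuous f}.
Proof. by move=> df; apply: derivable_within_continuous => t _; case: (df t). Qed.

Lemma nonincreasing_of_derive_le0 f (f' : R -> R) a b : a <= b ->
  (forall t, a < t < b -> is_derive t 1 f (f' t)) ->
  {within `[a, b], continuous f} ->
  (forall t, a < t < b -> f' t <= 0) -> f b <= f a.
Proof.
rewrite le_eqVlt => /predU1P[->//|ab] df cf f'le0.
have dfi x : x \in `]a, b[ -> is_derive x 1 f (f' x).
  by rewrite in_itv; exact: df.
have [c] := MVT ab dfi cf; rewrite in_itv /= => /f'le0 f'c fE.
by rewrite -subr_le0 fE mulr_le0_ge0// subr_ge0 ltW.
Qed.

Lemma gronwall D (D' : R -> R) L a b : a <= b ->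
  (forall t, a < t < b -> is_derive t 1 D (D' t)) ->
  {within `[a, b], continuous D} ->
  (forall t, a < t < b -> D' t <= L * D t) ->
  D b <= D a * expR (L * (b - a)).
Proof.
move=> ab dD cD D'le.
pose E t := expR (- L * t).
have dE t : is_derive t 1 E (- L * E t).
  rewrite /E; apply: is_derive_eq; rewrite /GRing.scale /= mulr1; ring.
have := @nonincreasing_of_derive_le0 (D * E) (fun t => (D' t - L * D t) * E t) a b ab.
rewrite /E /= => H.
have {}H : D b * expR (- L * b) <= D a * expR (- L * a).
  apply: H => [t tab|x|t tab].
  - have := dD t tab => dDt; have dEt := dE t.
    apply: is_derive_eq; rewrite /GRing.scale /= /E; ring.
  - apply: continuousM; first exact: cD.
    exact: (is_derive_within_continuous E _ _ _ dE).
  - by rewrite mulr_le0_ge0 ?expR_ge0// subr_le0 D'le.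
rewrite -(ler_pM2r (expR_gt0 (- L * b))) -mulrA -expRD.
by rewrite [_ + _](_ : _ = - L * a)//; ring.
Qed.

Lemma gronwall_backward D (D' : R -> R) L a b : a <= b ->
  (forall t, a < t < b -> is_derive t 1 D (D' t)) ->
  {within `[a, b], continuous D} ->
  (forall t, a < t < b -> - L * D t <= D' t) ->
  D a <= D b * expR (L * (b - a)).
Proof.
move=> ab dD cD leD'.
have : - D b <= - D a * expR (- L * (b - a)).
  apply: (@gronwall (- D) (- D')) => // [t /dD ?|x|t /leD'].
  - exact: is_deriveN.
  - by apply: continuousN; exact: cD.
  - by rewrite /GRing.opp /= mulrN lerN2.
rewrite mulNr lerN2 -(ler_pM2r (expR_gt0 (L * (b - a)))) -mulrA -expRD.
by rewrite mulNr addNr expR0 mulr1.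
Qed.

(** Gronwall in both directions for [f * f]; reading it backward is what makes
    the coordinate axes invariant under time reversal too. *)
Lemma zero_of_linear f h L a b : a <= b -> 0 <= L ->
  (forall t, a < t < b -> is_derive t 1 f (f t * h t)) ->
  {within `[a, b], continuous f} ->
  (forall t, a < t < b -> `|h t| <= L) -> (f a = 0) <-> (f b = 0).
Proof.
move=> ab L0 df cf hL.
have d2 t : a < t < b -> is_derive t 1 (f * f) (2 * (f t * f t) * h t).
  move=> /df dft; apply: is_derive_eq; rewrite /GRing.scale /=; ring.
have c2 : {within `[a, b], continuous (f * f)} by move=> x; apply: continuousM; exact: cf.
have ff t : 0 <= f t * f t by rewrite -expr2 sqr_ge0.
have bnd t : a < t < b -> - (2 * L) <= 2 * h t <= 2 * L.
  by move=> /hL; rewrite ler_norml => /andP[? ?]; apply/andP; split; lra.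
have zero t : f t * f t <= 0 -> f t = 0.
  by move=> ft0; apply/eqP; rewrite -sqrf_eq0 expr2 eq_le ft0 ff.
split=> f0; apply: zero.
- have : f b * f b <= f a * f a * expR (2 * L * (b - a)).
    apply: gronwall d2 c2 _ => // t tab; have /andP[_ le2] := bnd t tab.
    by rewrite mulrAC; exact: ler_wpM2r (ff t) _ _ le2.
  by rewrite f0 !mul0r.
- have : f a * f a <= f b * f b * expR (2 * L * (b - a)).
    apply: gronwall_backward d2 c2 _ => // t tab; have /andP[le1 _] := bnd t tab.
    by rewrite [leRHS]mulrAC; exact: ler_wpM2r (ff t) _ _ le1.
  by rewrite f0 !mul0r.
Qed.

Lemma last_passage f a b c : continuous f -> a <= b -> f a <= c -> c < f b ->
  exists s, [/\ a <= s, s < b, f s <= c & forall t, s < t <= b -> c < f t].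
Proof.
move=> cf ab fac cfb.
pose S := [set t | t <= b /\ f t <= c].
have S0 : S !=set0 by exists a.
have Sub : has_ubound S by exists b => t [].
have clS : closed S.
  apply: closedI; first exact: closed_le.
  exact: (preimage_closed (fun x _ => cf x) (@closed_le _ c)).
have [sb fs] : S (sup S) by apply: clS; exact: closure_sup.
exists (sup S); split => //.
- by apply: ub_le_sup.
- by rewrite lt_neqAle sb andbT; apply: contraTneq fs => ->; rewrite -ltNge.
- move=> t /andP[st tb]; rewrite ltNge; apply/negP => ftc.
  by move: st; rewrite ltNge ub_le_sup.
Qed.

(** A barrier argument: above the level [c] the function can only grow when time
    runs backward, so it never comes back to [c].  Between the last passage
    through a level below [f b] and the time [b] it would have to increase. *)
Lemma nonincreasing_backward f (f' : R -> R) b c :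
  (forall t, is_derive t 1 f (f' t)) ->
  (forall t, t <= b -> c < f t -> f' t <= 0) -> c < f b ->
  forall t, t <= b -> f b <= f t.
Proof.
move=> df f'le0 cfb a ab; rewrite leNgt; apply/negP => fab.
have cf : continuous f.
  by move=> x; apply/differentiable_continuous; apply/derivable1_diffP; case: (df x).
have fac : f a <= Num.max c (f a) by rewrite le_max lexx orbT.
have cfb' : Num.max c (f a) < f b by rewrite gt_max cfb.
(* the level must be at least c for the sign of the derivative to be known *)
have [s [as_ sb fs sf]] := last_passage f a b _ cf ab fac cfb'.
suff : f b <= f s by move=> fbs; move: (lt_le_trans cfb' (le_trans fbs fs)); rewrite ltxx.
apply: (@nonincreasing_of_derive_le0 f f') => [||t /andP[st /ltW tb]].
- exact: ltW.
- exact: is_derive_within_continuous df.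
- apply: f'le0 => //; apply: (@le_lt_trans _ _ (Num.max c (f a))).
    by rewrite le_max lexx.
  by apply: sf; rewrite st.
Qed.

(** Above the level [c] the function grows backward at least at the linear rate
    [k], which an upper bound excludes. *)
Lemma no_backward_escape f (f' : R -> R) b c k M : 0 < k ->
  (forall t, is_derive t 1 f (f' t)) -> (forall t, t <= b -> f t <= M) ->
  (forall t, t <= b -> c < f t -> f' t <= - k) -> f b <= c.
Proof.
move=> k0 df fM f'k; rewrite leNgt; apply/negP => cfb.
have fge t : t <= b -> c < f t.
  have f'le0 x : x <= b -> c < f x -> f' x <= 0.
    by move=> xb /(f'k x xb)/le_trans; apply; rewrite oppr_le0 ltW.
  by move=> /(nonincreasing_backward f f' b c df f'le0 cfb); exact: lt_le_trans.
(* going back this long raises the value by more than M - f b *)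
pose a := b - (`|M - f b| + 1) / k.
have ab : a <= b by rewrite gerBl divr_ge0 ?ltW// ?addr_ge0.
have dg t : is_derive t 1 (fun x => f x + k * x) (f' t + k).
  have dft := df t; apply: is_derive_eq; rewrite /GRing.scale /=; ring.
have : f b + k * b <= f a + k * a.
  apply: (nonincreasing_of_derive_le0 (fun x => f x + k * x)) => //.
  - exact: is_derive_within_continuous dg.
  - move=> t /andP[_ /ltW tb]; have := f'k t tb (fge t tb); lra.
have kab : k * a = k * b - (`|M - f b| + 1) by rewrite /a; field; lra.
have := fM a ab; have := ler_norm (M - f b); rewrite kab; lra.
Qed.

Lemma is_derive1_shift f (f' : R -> R) t c : is_derive (t + c) 1 f (f' (t + c)) ->
  is_derive t 1 (fun s => f (s + c)) (f' (t + c)).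
Proof.
move=> df; have dshift : is_derive t 1 (fun s : R => s + c) (1 : R).
  by apply: is_derive_eq; rewrite addr0.
have := @is_derive1_comp R f (fun s : R => s + c) t _ _ df dshift.
by rewrite mulr1.
Qed.

End Calculus.

(** * Complete orbits of a semiflow and its attractors *)

Section Semiflow.
Context {R : realType}.
Implicit Types (A K S : set (R * R)) (phi : R -> R * R -> R * R) (u : R -> R * R).

(** A point reached from [K] after arbitrarily long times is arbitrarily close to
    what attracts [K], uniformly over [K]. *)
Lemma attracted_mem phi A K x : closed A -> attracts phi A K ->
  (forall T, exists t, exists y, [/\ T <= t, K y & phi t y = x]) -> A x.
Proof.
move=> clA attK back; apply: clA => B /nbhs_ballP[e /= e0 eB].
have [T [_ attT]] := attK e e0.
have [t [y [Tt Ky yx]]] := back T.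
have [a Aa] := attT t y Tt Ky; rewrite yx => aex.
by exists a; split => //; apply: eB; exact: ball_sym.
Qed.

Lemma closed_of_compact A : compact A -> closed A.
Proof. by apply: compact_closed; exact: norm_hausdorff. Qed.

(** Each point of [K] is reached from [K] after arbitrarily long times, and the
    attractor attracts [K]. *)
Lemma subset_attractor phi S A K : global_attractor phi S A -> K `<=` S ->
  compact K -> (forall t x, 0 <= t -> K x -> exists2 y, K y & phi t y = x) -> K `<=` A.
Proof.
move=> [_ cA _ _ attA] KS cK Kinv x Kx.
apply: (attracted_mem phi A K _ (closed_of_compact _ cA) (attA K KS cK)) => T.
have [|y Ky yx] := Kinv (Num.max 0 T) x _ Kx; first by rewrite le_max lexx.
by exists (Num.max 0 T), y; rewrite le_max lexx orbT.
Qed.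

Lemma compact_coordinates_bounded A : compact A ->
  exists M, forall x, A x -> x.1 <= M /\ x.2 <= M.
Proof.
move=> /compact_bounded [M [_ MA]]; exists (M + 1) => x Ax.
have MM : M < M + 1 by rewrite ltrDl.
have : Num.max `|x.1| `|x.2| <= M + 1 := MA _ MM x Ax.
by rewrite ge_max => /andP[x1 x2]; split; apply: le_trans (ler_norm _) _.
Qed.

Definition complete_orbit phi A u : Prop :=
  (forall t, A (u t)) /\ (forall t s, 0 <= s -> u (t + s) = phi s (u t)).

(** Invariance gives each point a preimage under the time-one map inside [A]; a
    chain of such preimages is a backward orbit, filled in by the semiflow.  The
    value at [t] is computed from any point of the chain lying before [t]. *)
Lemma complete_orbit_through phi S A x : is_semiflow S phi -> A `<=` S ->
  Defs.invariant phi A -> A x -> exists2 u, complete_orbit phi A u & u 0 = x.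
Proof.
move=> sf AS invA Ax.
have /choice[g gP] : forall y, exists z, A y -> A z /\ phi 1 z = y.
  move=> y.
  have [Ay|nAy] := pselect (A y); last by exists y.
  by move: (Ay); rewrite -{1}(invA 1 ler01) => -[z Az zy]; exists z.
pose x_ n := iter n g x.
have Ax_ n : A (x_ n) by elim: n => [//|n /gP[]].
have phi_x m n : phi m%:R (x_ (m + n)%N) = x_ n.
  elim: m => [|m IHm]; first by rewrite (semiflow0 sf) //; exact: AS.
  rewrite -addn1 natrD (semiflowD sf) ?ler01 ?ler0n//; last exact: AS.
  by rewrite addn1 addSn (gP _ (Ax_ _)).2.
have consistent (t : R) m n : (m <= n)%N -> 0 <= t + m%:R ->
    phi (t + n%:R) (x_ n) = phi (t + m%:R) (x_ m).
  move=> mn tm; rewrite -{1 2}(subnK mn) natrD (addrC _ m%:R) addrA.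
  by rewrite (semiflowD sf) ?phi_x//; exact: AS.
pose N (t : R) := Num.bound `|t|.
have N0 t n : (N t <= n)%N -> 0 <= t + n%:R.
  move=> Nn; have := archi_boundP (normr_ge0 t); rewrite -/(N t).
  have : (N t)%:R <= n%:R :> R by rewrite ler_nat.
  by have := ler_norm (- t); rewrite normrN; lra.
pose u t := phi (t + (N t)%:R) (x_ (N t)).
have uE t n : (N t <= n)%N -> u t = phi (t + n%:R) (x_ n).
  by move=> Nn; rewrite /u (consistent t _ _ Nn)// N0.
have invA' t y : 0 <= t -> A y -> A (phi t y).
  by move=> t0 Ay; rewrite -(invA t t0); exists y.
exists u; first split.
- by move=> t; apply: invA' => //; exact: N0.
- move=> t s s0; pose n := maxn (N t) (N (t + s)).
  rewrite (uE t n) ?leq_maxl// (uE _ n) ?leq_maxr//.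
  rewrite -addrA addrCA (semiflowD sf)//; last exact: AS.
  by apply: N0; rewrite leq_maxl.
- rewrite (uE 0 (N 0)) // add0r; have := phi_x (N 0) 0%N.
  by rewrite addn0.
Qed.

Lemma within_continuous_comp (T U V : topologicalType) (D : set U) (I : set T)
    (F : U -> V) (g : T -> U) : {within D, continuous F} -> continuous g ->
  (forall s, I s -> D (g s)) -> {within I, continuous (F \o g)}.
Proof.
move=> /subspace_continuousP cF cg gI; apply/subspace_continuousP => s Is.
have gs : g x @[x --> within I (nbhs s)] --> within D (nbhs (g s)).
  move=> P /cg DP; have {}DP : nbhs s (fun r => D (g r) -> P (g r)) := DP.
  change (nbhs s (fun r => I r -> P (g r))).
  by apply: filterS DP => r DP Ir; apply: DP; exact: gI.
exact: cvg_comp gs (cF (g s) (gI s Is)).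
Qed.

Lemma cvg_fst_snd u (F : set_system R) (p : R * R) : Filter F -> u t @[t --> F] --> p ->
  (u t).1 @[t --> F] --> p.1 /\ (u t).2 @[t --> F] --> p.2.
Proof.
case: p => a b FF up; split.
- exact: cvg_comp up cvg_fst.
- exact: cvg_comp up cvg_snd.
Qed.

Lemma within_fst_snd (I : set R) (F : R -> R * R) : {within I, continuous F} ->
  {within I, continuous (fun t => (F t).1)} /\ {within I, continuous (fun t => (F t).2)}.
Proof.
by move=> /subspace_continuousP cF; split; apply/subspace_continuousP => s /cF /cvg_fst_snd[].
Qed.

Lemma int_quadrantW : int_quadrant `<=` @quadrant R.
Proof. by move=> x [? ?]; split; exact: ltW. Qed.

End Semiflow.

(** * Complete solutions of the predator-prey system *)

Section PredatorPrey.
Context {R : realType} (alpha beta gamma : R).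
Context (alpha_gt0 : 0 < alpha) (beta_gt0 : 0 < beta) (gamma_gt0 : 0 < gamma).
Implicit Types (p q x : R * R) (u v : R -> R * R) (A B K : set (R * R)).
Implicit Types (M T t : R).

Definition complete_solution u : Prop :=
  (forall t, solves_at alpha beta gamma u t) /\ (forall t, quadrant (u t)).

Definition prey_growth x : R := alpha * (gamma - x.1) - x.2 / (1 + x.1).
Definition predator_growth x : R := beta * (x.1 / (1 + x.1)) - 1.

Lemma prey_rateE x : prey_rate alpha gamma x = x.1 * prey_growth x.
Proof. by rewrite /prey_rate /prey_growth; ring. Qed.

Lemma predator_rateE x : predator_rate beta x = x.2 * predator_growth x.
Proof. by rewrite /predator_rate /predator_growth; ring. Qed.

Lemma response_itv (x : R) : 0 <= x -> 0 <= x / (1 + x) <= 1.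
Proof.
move=> x0; have x1 : 0 < 1 + x by lra.
by rewrite divr_ge0 ?(ltW x1)//= ler_pdivrMr// mul1r; lra.
Qed.

Lemma div_shift_le (x y : R) : 0 <= x -> 0 <= y -> 0 <= y / (1 + x) <= y.
Proof.
move=> x0 y0; have x1 : 0 < 1 + x by lra.
by rewrite divr_ge0 ?(ltW x1)//= ler_pdivrMr//; nra.
Qed.

Lemma predator_growth_norm x : quadrant x -> `|predator_growth x| <= 1 + beta.
Proof.
move=> [x1 _]; have /andP[r0 r1] := response_itv _ x1.
have b0 : 0 <= beta * (x.1 / (1 + x.1)) by rewrite mulr_ge0// ltW.
have b1 : beta * (x.1 / (1 + x.1)) <= beta by rewrite ler_piMr// ltW.
by rewrite ler_norml /predator_growth; apply/andP; split; lra.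
Qed.

Lemma prey_growth_norm x M : quadrant x -> x.1 <= M -> x.2 <= M ->
  `|prey_growth x| <= alpha * gamma + alpha * M + M.
Proof.
move=> [x1 x2] x1M x2M; have /andP[r0 r1] := div_shift_le _ _ x1 x2.
have ax0 : 0 <= alpha * x.1 by rewrite mulr_ge0// ltW.
have axM : alpha * x.1 <= alpha * M by rewrite ler_wpM2l// ltW.
have ag0 : 0 <= alpha * gamma by rewrite mulr_ge0// ltW.
by rewrite ler_norml /prey_growth; apply/andP; split; lra.
Qed.

Lemma zero_of_linear_complete (f h : R -> R) L : 0 <= L ->
  (forall t, is_derive t 1 f (f t * h t)) -> (forall t, `|h t| <= L) ->
  forall s t, f s = 0 -> f t = 0.
Proof.
move=> L0 df hL s t.
have aux a b : a <= b -> (f a = 0) <-> (f b = 0).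
  move=> ab; apply: (@zero_of_linear R f h L) => //.
  exact: is_derive_within_continuous df.
by case: (leP s t) => [/aux[]//|/ltW/aux[]].
Qed.

Lemma solves_at_prey u t : solves_at alpha beta gamma u t ->
  is_derive t 1 (fun s => (u s).1) ((u t).1 * prey_growth (u t)).
Proof. by rewrite -prey_rateE => -[]. Qed.

Lemma solves_at_predator u t : solves_at alpha beta gamma u t ->
  is_derive t 1 (fun s => (u s).2) ((u t).2 * predator_growth (u t)).
Proof. by rewrite -predator_rateE => -[]. Qed.

Lemma prey_zero u M : complete_solution u ->
  (forall t, (u t).1 <= M /\ (u t).2 <= M) ->
  forall s t, (u s).1 = 0 -> (u t).1 = 0.
Proof.
move=> [su qu] uM; pose L := alpha * gamma + alpha * M + M.
apply: (@zero_of_linear_complete (fun t => (u t).1) (prey_growth \o u) L).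
- have [u1 _] := qu 0; have [uM1 _] := uM 0.
  have M0 : 0 <= M := le_trans u1 uM1.
  by rewrite !addr_ge0// mulr_ge0// ltW.
- by move=> t; exact: solves_at_prey.
- by move=> t; have [? ?] := uM t; exact: prey_growth_norm.
Qed.

Lemma predator_zero u : complete_solution u ->
  forall s t, (u s).2 = 0 -> (u t).2 = 0.
Proof.
move=> [su qu].
apply: (@zero_of_linear_complete (fun t => (u t).2) (predator_growth \o u) (1 + beta)).
- by rewrite addr_ge0// ltW.
- by move=> t; exact: solves_at_predator.
- by move=> t; exact: predator_growth_norm.
Qed.

(** Above [gamma] the prey decreases at a rate bounded away from zero, hence grows
    without bound backward. *)
Lemma prey_le_capacity u M : complete_solution u -> (forall t, (u t).1 <= M) ->
  forall t, (u t).1 <= gamma.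
Proof.
move=> [su qu] uM t; rewrite leNgt; apply/negP => ut.
pose c := (gamma + (u t).1) / 2.
have cg : gamma < c by rewrite /c; lra.
have : (u t).1 <= c.
  apply: (@no_backward_escape R (fun s => (u s).1) _ t c
    (alpha * gamma * (c - gamma)) M _ (fun s => solves_at_prey _ _ (su s))) => //.
  - by rewrite !mulr_gt0// subr_gt0.
  - move=> s _ cs; have [u1 u2] := qu s.
    have /andP[r0 _] := div_shift_le _ _ u1 u2.
    rewrite /prey_growth.
    have : alpha * gamma * (c - gamma) <= alpha * (u s).1 * ((u s).1 - gamma).
      apply: ler_pM; rewrite ?mulr_ge0 ?(ltW alpha_gt0) ?(ltW gamma_gt0)//; try lra.
      by rewrite ler_pM2l//; lra.
    have : 0 <= (u s).1 * ((u s).2 / (1 + (u s).1)) by rewrite mulr_ge0.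
    lra.
rewrite /c; lra.
Qed.

(** Divided differences of the two rates between [p] and [q].  They turn the
    equation for the difference of two solutions into an exact linear one, whose
    fourth coefficient is [predator_growth q]. *)
Definition slope11 p q : R :=
  alpha * gamma - alpha * (p.1 + q.1) - p.2 / (1 + p.1) / (1 + q.1).
Definition slope12 q : R := - (q.1 / (1 + q.1)).
Definition slope21 p q : R := beta * (p.2 / (1 + p.1) / (1 + q.1)).

Lemma prey_rate_diff p q : quadrant p -> quadrant q ->
  prey_rate alpha gamma p - prey_rate alpha gamma q =
  slope11 p q * (p.1 - q.1) + slope12 q * (p.2 - q.2).
Proof.
move=> [p1 _] [q1 _]; rewrite /prey_rate /slope11 /slope12; field.
by apply/andP; split; apply: lt0r_neq0; lra.
Qed.

Lemma predator_rate_diff p q : quadrant p -> quadrant q ->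
  predator_rate beta p - predator_rate beta q =
  slope21 p q * (p.1 - q.1) + predator_growth q * (p.2 - q.2).
Proof.
move=> [p1 _] [q1 _]; rewrite /predator_rate /slope21 /predator_growth; field.
by apply/andP; split; apply: lt0r_neq0; lra.
Qed.

(** The left-hand side is the derivative of [x ^ 2 + y ^ 2] along the linear
    system with coefficients [a], [b], [c], [d]. *)
Lemma quadratic_form_bound (a b c d K x y : R) :
  `|a| <= K -> `|b| <= K -> `|c| <= K -> `|d| <= K ->
  `|2 * x * (a * x + b * y) + 2 * y * (c * x + d * y)| <= 4 * K * (x * x + y * y).
Proof.
move=> aK bK cK dK; have K0 : 0 <= K := le_trans (normr_ge0 a) aK.
have term (m z : R) : `|m| <= K -> `|m * z| <= K * `|z|.
  by move=> mK; rewrite normrM ler_wpM2r.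
have xx : `|x * x| = x * x by rewrite ger0_norm// -expr2 sqr_ge0.
have yy : `|y * y| = y * y by rewrite ger0_norm// -expr2 sqr_ge0.
have := term a (x * x) aK; rewrite xx => /ler_normlP[? ?].
have /ler_normlP[? ?] := term b (x * y) bK.
have /ler_normlP[? ?] := term c (x * y) cK.
have := term d (y * y) dK; rewrite yy => /ler_normlP[? ?].
have xy : K * (2 * `|x * y|) <= K * (x * x + y * y).
  rewrite ler_wpM2l// normrM -[x * x]xx -[y * y]yy !normrM.
  by have := sqr_ge0 (`|x| - `|y|); lra.
have Kx : 0 <= K * (x * x) by rewrite mulr_ge0// -expr2 sqr_ge0.
have Ky : 0 <= K * (y * y) by rewrite mulr_ge0// -expr2 sqr_ge0.
by apply/ler_normlP; split; lra.
Qed.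

Lemma is_derive_diff_prey u v t :
  solves_at alpha beta gamma u t -> solves_at alpha beta gamma v t ->
  quadrant (u t) -> quadrant (v t) ->
  is_derive t 1 (fun s => (u s).1 - (v s).1)
    (slope11 (u t) (v t) * ((u t).1 - (v t).1)
     + slope12 (v t) * ((u t).2 - (v t).2)).
Proof. by move=> [? _] [? _] qu qv; rewrite -prey_rate_diff//; exact: is_deriveB. Qed.

Lemma is_derive_diff_predator u v t :
  solves_at alpha beta gamma u t -> solves_at alpha beta gamma v t ->
  quadrant (u t) -> quadrant (v t) ->
  is_derive t 1 (fun s => (u s).2 - (v s).2)
    (slope21 (u t) (v t) * ((u t).1 - (v t).1)
     + predator_growth (v t) * ((u t).2 - (v t).2)).
Proof. by move=> [_ ?] [_ ?] qu qv; rewrite -predator_rate_diff//; exact: is_deriveB. Qed.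

Lemma is_derive_bounded (f f' : R -> R) a b : (forall t, is_derive t 1 f (f' t)) ->
  a <= b -> exists M, forall t, a <= t <= b -> f t <= M.
Proof.
move=> df ab.
have [c _ fc] := EVT_max ab (is_derive_within_continuous f f' a b df).
by exists (f c) => t tab; apply: fc; rewrite in_itv.
Qed.

(** Gronwall in both directions for the squared distance: on a compact time
    interval the solutions are bounded, hence so are the divided differences. *)
Lemma complete_solution_unique u v : complete_solution u -> complete_solution v ->
  forall s t, u s = v s -> u t = v t.
Proof.
move=> [su qu] [sv qv] s t.
pose x t := (u t).1 - (v t).1; pose y t := (u t).2 - (v t).2.
pose D t := x t * x t + y t * y t.
pose D' t := 2 * x t * (slope11 (u t) (v t) * x t + slope12 (v t) * y t)
  + 2 * y t * (slope21 (u t) (v t) * x t + predator_growth (v t) * y t).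
have dD (r : R) : is_derive r 1 D (D' r).
  have dx := is_derive_diff_prey _ _ _ (su r) (sv r) (qu r) (qv r).
  have dy := is_derive_diff_predator _ _ _ (su r) (sv r) (qu r) (qv r).
  rewrite -/(x r) -/(y r) in dx dy.
  have := is_deriveD (is_deriveM dx dx) (is_deriveM dy dy).
  move=> /is_derive_eq; apply; rewrite /GRing.scale /= /D'.
  rewrite /x /y; ring.
have D0 r : D r <= 0 -> u r = v r.
  have xx0 := sqr_ge0 (x r); have yy0 := sqr_ge0 (y r).
  rewrite /D -!expr2 => Dr.
  have /eqP : x r ^+ 2 = 0 by lra.
  have /eqP : y r ^+ 2 = 0 by lra.
  rewrite !sqrf_eq0 !subr_eq0 => /eqP y0 /eqP x0.
  by rewrite [LHS]surjective_pairing x0 y0 -surjective_pairing.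
have D0' r : u r = v r -> D r = 0.
  by move=> uv; rewrite /D /x /y uv !subrr mulr0 addr0.
have bound a b : a <= b -> exists L, forall r, a < r < b -> `|D' r| <= L * D r.
  move=> ab.
  have [M1 uM1] := is_derive_bounded _ _ _ _ (fun t => solves_at_prey _ _ (su t)) ab.
  have [M2 uM2] := is_derive_bounded _ _ _ _ (fun t => solves_at_predator _ _ (su t)) ab.
  have [M3 vM3] := is_derive_bounded _ _ _ _ (fun t => solves_at_prey _ _ (sv t)) ab.
  pose K := alpha * gamma + alpha * (M1 + M3) + M2 + beta * M2 + 1 + beta.
  exists (4 * K) => r /andP[/ltW ar /ltW rb].
  have {uM1} := uM1 r; have {uM2} := uM2 r; have {vM3} := vM3 r.
  rewrite ar rb => /(_ isT) vM3 /(_ isT) uM2 /(_ isT) uM1.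
  have [u1 u2] := qu r; have [v1 v2] := qv r.
  have ag0 : 0 <= alpha * gamma by rewrite mulr_ge0// ltW.
  have auv0 : 0 <= alpha * ((u r).1 + (v r).1) by rewrite mulr_ge0 ?addr_ge0// ltW.
  have auvM : alpha * ((u r).1 + (v r).1) <= alpha * (M1 + M3).
    by rewrite ler_wpM2l ?lerD// ltW.
  have b0 : 0 <= beta := ltW beta_gt0.
  have /andP[w0 w1] := div_shift_le _ _ u1 u2.
  have /andP[z0 z1] := div_shift_le _ _ v1 w0.
  have bz0 : 0 <= beta * ((u r).2 / (1 + (u r).1) / (1 + (v r).1)) by rewrite mulr_ge0.
  have bzM : beta * ((u r).2 / (1 + (u r).1) / (1 + (v r).1)) <= beta * M2.
    by rewrite ler_wpM2l//; lra.
  have /andP[q0 q1] := response_itv _ v1.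
  have /ler_normlP[g0 g1] := predator_growth_norm _ (qv r).
  apply: quadratic_form_bound; apply/ler_normlP;
    rewrite /slope11 /slope12 /slope21 /K; split; lra.
have aux a b : a <= b -> (u a = v a) <-> (u b = v b).
  move=> ab; have [L D'L] := bound a b ab.
  have cD := is_derive_within_continuous D D' a b dD.
  split=> [/D0' Da|/D0' Db]; apply: D0.
  - rewrite -(mul0r (expR (L * (b - a)))) -Da.
    by apply: gronwall cD _ => // r /D'L; exact: ler_normlW.
  - rewrite -(mul0r (expR (L * (b - a)))) -Db.
    apply: gronwall_backward cD _ => // r /D'L.
    by rewrite ler_norml mulNr => /andP[].
by case: (leP s t) => [/aux[]//|/ltW/aux[]].
Qed.

(** * Uniqueness of the orbit leaving the saddle *)

Context (hgb : 1 < gamma * (beta - 1)).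

(** The predator grows exactly when the prey exceeds [1 / (beta - 1)], which is
    less than [gamma]: this is the unstable direction of the saddle.  The bound
    [3 / 4 * gamma] keeps the prey direction contracting. *)
Lemma saddle_threshold : exists c,
  [/\ 3 / 4 * gamma <= c, c < gamma & 0 < beta * (c / (1 + c)) - 1].
Proof.
have h := hgb; have b1 : 0 < beta - 1.
  by rewrite ltNge; apply/negP => b1; have := mulr_ge0_le0 (ltW gamma_gt0) b1; lra.
pose m := (1 / (beta - 1) + gamma) / 2.
have sg : 1 / (beta - 1) < gamma by rewrite ltr_pdivrMr.
have g0 := gamma_gt0.
exists (Num.max (3 / 4 * gamma) m); split.
- by rewrite le_max lexx.
- rewrite gt_max /m; apply/andP; split; lra.
- set c := Num.max _ _.
  have cm : m <= c by rewrite le_max lexx orbT.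
  have c1 : 1 / (beta - 1) < c by rewrite /m in cm; lra.
  have c0 : 0 < c by apply: lt_trans c1; rewrite divr_gt0.
  rewrite ltr_pdivrMr// in c1.
  by rewrite subr_gt0 mulrA ltr_pdivlMr; lra.
Qed.

Lemma response_mono (x c : R) : 0 <= c -> c <= x -> c / (1 + c) <= x / (1 + x).
Proof.
move=> c0 cx; rewrite ler_pdivrMr; last lra.
by rewrite mulrAC ler_pdivlMr; lra.
Qed.

(** The left-hand side is the derivative of [x ^ 2 - k * y ^ 2] along the linear
    system with coefficients [a], [b], [c], [d], contracting in [x] at rate at
    least [p / 2] and expanding in [y] at rate at least [d0].  This [k] makes the
    upper bound [- p * x ^ 2 + 4 * |x * y| - 4 / p * y ^ 2] minus a square. *)
Lemma cone_form_le0 (p a b c d k d0 x y : R) : 0 < p -> 0 < d0 ->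
  k = 2 / (p * d0) -> 2 * a <= - p -> -1 <= b <= 0 -> 0 <= c -> k * c <= 1 ->
  d0 <= d -> 2 * x * (a * x + b * y) - k * (2 * y * (c * x + d * y)) <= 0.
Proof.
move=> p0 d00 kE ap /andP[b1 b0] c0 kc1 d0d.
have k0 : 0 < k by rewrite kE divr_gt0// mulr_gt0.
have kd0 : k * d0 = 2 / p by rewrite kE; field; rewrite !lt0r_neq0.
have kd : 2 / p <= k * d by rewrite -kd0 ler_pM2l.
have xx0 : 0 <= x ^+ 2 := sqr_ge0 x.
have yy0 : 0 <= y ^+ 2 := sqr_ge0 y.
have kc0 : 0 <= k * c by rewrite mulr_ge0// ltW.
have E1 : (2 * a) * x ^+ 2 <= - p * x ^+ 2 by rewrite ler_wpM2r.
have E2 : 2 / p * y ^+ 2 <= k * d * y ^+ 2 by rewrite ler_wpM2r.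
have E3 : (b - k * c) * (x * y) <= 2 * `|x * y|.
  apply: le_trans (ler_norm _) _; rewrite normrM ler_wpM2r//.
  by rewrite ler_norml; apply/andP; split; lra.
have E4 : 4 * `|x * y| <= p * x ^+ 2 + 4 / p * y ^+ 2.
  have : 0 <= (p * `|x| - 2 * `|y|) ^+ 2 / p by rewrite divr_ge0 ?sqr_ge0 ?ltW.
  rewrite normrM -(real_normK (num_real x)) -(real_normK (num_real y)).
  suff -> : (p * `|x| - 2 * `|y|) ^+ 2 / p =
    p * `|x| ^+ 2 - 4 * (`|x| * `|y|) + 4 / p * `|y| ^+ 2 by lra.
  by field; rewrite lt0r_neq0.
have p4 : 4 / p * y ^+ 2 = 2 * (2 / p * y ^+ 2) by ring.
lra.
Qed.

(** Solutions emanating from the saddle differ mostly in the unstable direction: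
    with [x] and [y] their differences of prey and of predator,
    [Q := x ^ 2 - k * y ^ 2] is nonincreasing near the saddle and starts from [0]
    at minus infinity. *)
Lemma unstable_cone : exists c e k, [/\ c < gamma, 0 < e &
  forall u v T, complete_solution u -> complete_solution v ->
    u t @[t --> -oo] --> (gamma, 0) -> v t @[t --> -oo] --> (gamma, 0) ->
    (forall t, t <= T -> c < (u t).1 /\ (u t).2 < e) ->
    (forall t, t <= T -> c < (v t).1 /\ (v t).2 < e) ->
    ((u T).1 - (v T).1) ^+ 2 <= k * ((u T).2 - (v T).2) ^+ 2].
Proof.
have [c [gc cg d00]] := saddle_threshold.
set d0 := beta * _ - 1 in d00.
have g0 := gamma_gt0; have b0 := beta_gt0.
have c0 : 0 < c by lra.
pose p := alpha * gamma; have p0 : 0 < p by rewrite mulr_gt0.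
pose k := 2 / (p * d0); have k0 : 0 < k by rewrite divr_gt0// mulr_gt0.
(* the bound on the predator makes k * slope21 at most 1 *)
exists c, (1 / (k * beta)), k; split => //.
  by rewrite divr_gt0// mulr_gt0.
move=> u v T [su qu] [sv qv] ulim vlim uT vT.
pose x t := (u t).1 - (v t).1; pose y t := (u t).2 - (v t).2.
pose Q t := x t * x t - k * (y t * y t).
pose Q' t := 2 * x t * (slope11 (u t) (v t) * x t + slope12 (v t) * y t)
  - k * (2 * y t * (slope21 (u t) (v t) * x t + predator_growth (v t) * y t)).
have dQ (t : R) : is_derive t 1 Q (Q' t).
  have dx := is_derive_diff_prey _ _ _ (su t) (sv t) (qu t) (qv t).
  have dy := is_derive_diff_predator _ _ _ (su t) (sv t) (qu t) (qv t).
  have := is_deriveB (is_deriveM dx dx) (is_deriveZ k (is_deriveM dy dy)).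
  move=> /is_derive_eq; apply; rewrite /GRing.scale /= /Q' /x /y; ring.
have Q'le0 t : t <= T -> Q' t <= 0.
  move=> tT; have [uc ue] := uT t tT; have [vc ve] := vT t tT.
  have [u1 u2] := qu t; have [v1 v2] := qv t.
  have /andP[w0 w1] := div_shift_le _ _ u1 u2.
  have /andP[z0 z1] := div_shift_le _ _ v1 w0.
  have /andP[q0 q1] := response_itv _ v1.
  apply: (cone_form_le0 p _ _ _ _ k d0) => //.
  - have : alpha * (3 / 2 * gamma) <= alpha * ((u t).1 + (v t).1).
      by rewrite ler_wpM2l ?ltW//; lra.
    rewrite /slope11 /p; lra.
  - by rewrite /slope12; apply/andP; split; lra.
  - by rewrite /slope21 mulr_ge0// ltW.
  - rewrite /slope21 mulrA; apply: (@le_trans _ _ (k * beta * (1 / (k * beta)))).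
      rewrite ler_wpM2l//; first by rewrite mulr_ge0// ltW.
      lra.
    by rewrite mul1r divff// lt0r_neq0// mulr_gt0.
  - rewrite /d0 /predator_growth lerD2r ler_wpM2l ?(ltW b0)//.
    by apply: response_mono; apply: ltW.
have Qmono t : t <= T -> Q T <= Q t.
  move=> tT; apply: (nonincreasing_of_derive_le0 Q Q' _ _ tT) => //.
  - exact: is_derive_within_continuous dQ.
  - by move=> r /andP[_ /ltW /Q'le0].
have Qlim : Q t @[t --> -oo] --> 0.
  have [u1 u2] := cvg_fst_snd _ _ _ _ ulim; have [v1 v2] := cvg_fst_snd _ _ _ _ vlim.
  have x0 : x t @[t --> -oo] --> 0 by rewrite -(subrr gamma); exact: cvgB u1 v1.
  have y0 : y t @[t --> -oo] --> 0 by rewrite -(subrr (0 : R)); exact: cvgB u2 v2.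
  have -> : 0 = 0 * 0 - k * (0 * 0) :> R by rewrite !mulr0 subr0.
  by apply: cvgB; [exact: cvgM|apply: cvgM; [exact: cvg_cst|exact: cvgM]].
have : Q T <= 0.
  apply: (cvgr_to_ge Qlim); exists T; split; first exact: num_real.
  by move=> t /ltW /Qmono.
by rewrite /Q subr_le0 -!expr2.
Qed.

Lemma complete_solution_shift u s : complete_solution u ->
  complete_solution (fun t => u (t + s)).
Proof.
move=> [su qu]; split => [t|t]; last exact: qu.
have [d1 d2] := su (t + s); split.
- exact: (is_derive1_shift _ (fun r => prey_rate alpha gamma (u r))) d1.
- exact: (is_derive1_shift _ (fun r => predator_rate beta (u r))) d2.
Qed.

Lemma cvg_shift_ninfty u p s : u t @[t --> -oo] --> p ->
  u (t + s) @[t --> -oo] --> p.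
Proof.
move=> up; apply: cvg_comp up => P [N [_ NP]].
exists (N - s); split; first exact: num_real.
by move=> t tN; apply: NP; rewrite -ltrBrDr.
Qed.

Lemma near_saddle u c e : c < gamma -> 0 < e -> u t @[t --> -oo] --> (gamma, 0) ->
  exists T, forall t, t <= T -> c < (u t).1 /\ (u t).2 < e.
Proof.
move=> cg e0 /cvg_fst_snd[u1 u2].
have [N1 [_ N1P]] := cvgr_gt _ u1 _ cg; have [N2 [_ N2P]] := cvgr_lt _ u2 _ e0.
exists (Num.min N1 N2 - 1) => t tN.
have tN' : t < Num.min N1 N2 by apply: le_lt_trans tN _; rewrite ltrBlDr ltrDl.
by move: tN'; rewrite lt_min => /andP[/N1P ? /N2P].
Qed.

Lemma match_predator u T (y : R) : complete_solution u -> (forall t, 0 < (u t).2) ->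
  u t @[t --> -oo] --> (gamma, 0) -> 0 < y -> y <= (u T).2 ->
  exists2 s, s <= T & (u s).2 = y.
Proof.
move=> [su _] u0 ulim y0 yT.
have gg : gamma - 1 < gamma by rewrite ltrBlDr ltrDl.
have [N NP] := near_saddle _ _ _ gg y0 ulim.
pose a := Num.min N T.
have aT : a <= T by rewrite ge_min lexx orbT.
have [_ ay] : gamma - 1 < (u a).1 /\ (u a).2 < y by apply: NP; rewrite ge_min lexx.
have [|s sab <-] := @IVT R (fun t => (u t).2) a T y aT
    (is_derive_within_continuous _ _ _ _ (fun t => solves_at_predator _ _ (su t))).
  by rewrite ge_min (ltW ay)/= le_max yT orbT.
by exists s => //; move: sab; rewrite in_itv => /andP[].
Qed.

(** When the predators agree at [T], the cone condition leaves no room for a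
    difference of the prey. *)
Lemma emanating_solutions_agree : exists c e, [/\ c < gamma, 0 < e &
  forall u v T, complete_solution u -> complete_solution v ->
    u t @[t --> -oo] --> (gamma, 0) -> v t @[t --> -oo] --> (gamma, 0) ->
    (forall t, t <= T -> c < (u t).1 /\ (u t).2 < e) ->
    (forall t, t <= T -> c < (v t).1 /\ (v t).2 < e) ->
    (u T).2 = (v T).2 -> forall t, u t = v t].
Proof.
have [c [e [k [cg e0 cone]]]] := unstable_cone.
exists c, e; split => // u v T su sv ulim vlim uT vT uv2 t.
apply: (complete_solution_unique _ _ su sv T).
have := cone _ _ _ su sv ulim vlim uT vT.
rewrite uv2 subrr expr0n /= mulr0 => le0.
have : ((u T).1 - (v T).1) ^+ 2 = 0 by apply/eqP; rewrite eq_le le0 sqr_ge0.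
move/eqP; rewrite sqrf_eq0 subr_eq0 => /eqP uv1.
by rewrite [LHS]surjective_pairing uv1 uv2 -surjective_pairing.
Qed.

(** The predator vanishes at minus infinity, so the solution with the larger
    predator at [T] had the predator of the other one at an earlier time. *)
Lemma emanating_solution_unique u v : complete_solution u -> complete_solution v ->
  (forall t, 0 < (u t).2) -> (forall t, 0 < (v t).2) ->
  u t @[t --> -oo] --> (gamma, 0) -> v t @[t --> -oo] --> (gamma, 0) ->
  exists tau, forall t, v t = u (t + tau).
Proof.
have [c [e [cg e0 agree]]] := emanating_solutions_agree.
have aligned u' v' T : complete_solution u' -> complete_solution v' ->
    (forall t, 0 < (u' t).2) -> (forall t, 0 < (v' t).2) ->
    u' t @[t --> -oo] --> (gamma, 0) -> v' t @[t --> -oo] --> (gamma, 0) ->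
    (forall t, t <= T -> c < (u' t).1 /\ (u' t).2 < e) ->
    (forall t, t <= T -> c < (v' t).1 /\ (v' t).2 < e) ->
    (v' T).2 <= (u' T).2 -> exists tau, forall t, v' t = u' (t + tau).
  move=> su sv u0 v0 ulim vlim uT vT le.
  have [s sT us] := match_predator _ _ _ su u0 ulim (v0 T) le.
  exists (s - T) => t; apply: (agree v' (fun t => u' (t + (s - T))) T) => //.
  - exact: complete_solution_shift.
  - exact: cvg_shift_ninfty.
  - by move=> r rT; apply: uT; lra.
  - by rewrite addrC subrK us.
move=> su sv u0 v0 ulim vlim.
have [N1 uN] := near_saddle _ _ _ cg e0 ulim.
have [N2 vN] := near_saddle _ _ _ cg e0 vlim.
pose T := Num.min N1 N2.
have uT t : t <= T -> c < (u t).1 /\ (u t).2 < e.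
  by rewrite le_min => /andP[/uN].
have vT t : t <= T -> c < (v t).1 /\ (v t).2 < e.
  by rewrite le_min => /andP[_ /vN].
have [le|/ltW le] := leP (v T).2 (u T).2; first exact: aligned le.
have [tau uv] := aligned v u T sv su v0 u0 vlim ulim vT uT le.
by exists (- tau) => t; rewrite uv subrK.
Qed.

(** * Solutions that approach the axes in the remote past *)

Lemma predator_growth_scarce x : quadrant x -> x.1 < 1 / (2 * beta) ->
  predator_growth x <= - (1 / 2).
Proof.
move=> [x1 _]; have /andP[r0 r1] := div_shift_le _ _ x1 x1.
rewrite ltr_pdivlMr ?mulr_gt0// /predator_growth => xb.
have : beta * (x.1 / (1 + x.1)) <= beta * x.1 by rewrite ler_wpM2l// ltW.
lra.
Qed.

(** If the predator were above a small level at some early time, the prey would be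
    below it there; the predator would decay, that is, grow backward, remain
    above the level, and be unbounded. *)
Lemma predator_vanishes_backward u M : complete_solution u ->
  (forall t, (u t).2 <= M) ->
  (forall e, 0 < e -> exists T, forall t, t <= T -> (u t).1 < e \/ (u t).2 < e) ->
  forall e, 0 < e -> exists T, forall t, t <= T -> (u t).2 <= e.
Proof.
move=> [su qu] uM leaves e e0.
pose e' := Num.min e (1 / (2 * beta)).
have e'0 : 0 < e' by rewrite lt_min e0 divr_gt0// mulr_gt0.
have [T uT] := leaves e' e'0.
exists T => t tT; apply: (@le_trans _ _ e'); last by rewrite ge_min lexx.
apply: (@no_backward_escape R (fun s => (u s).2) _ t e' (e' / 2) M _
  (fun s => solves_at_predator _ _ (su s))) => //; first exact: divr_gt0.
move=> s st e'u.
have us : (u s).1 < 1 / (2 * beta).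
  have [/lt_le_trans->//|] := uT s (le_trans st tT); first by rewrite ge_min lexx orbT.
  by move=> /(lt_trans e'u); rewrite ltxx.
have := ler_wpM2l (qu s).2 (predator_growth_scarce _ (qu s) us); lra.
Qed.

(** With a negligible predator, prey below [gamma - e] grows at a positive
    exponential rate, so it stays below backward and becomes scarce at some time
    [a].  Before [a] the predator decays, so it is unbounded backward. *)
Lemma prey_recovers_backward u M : complete_solution u ->
  (forall t, 0 < (u t).2) -> (forall t, (u t).2 <= M) ->
  (forall e, 0 < e -> exists T, forall t, t <= T -> (u t).2 <= e) ->
  forall e, 0 < e -> exists T, forall t, t <= T -> gamma - e <= (u t).1.
Proof.
move=> [su qu] v0 vM vlim e e0.
have ae : 0 < alpha * e / 2 by rewrite divr_gt0// mulr_gt0.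
have [T vT] := vlim _ ae.
exists T => b bT; rewrite leNgt; apply/negP => ub.
have dN (t : R) : is_derive t 1 (fun s => - (u s).1) (- ((u t).1 * prey_growth (u t))).
  by have d1 := solves_at_prey _ _ (su t); exact: is_deriveN.
have grows t : t <= b -> (u t).1 < gamma - e -> alpha * e / 2 <= prey_growth (u t).
  move=> tb ut; have [u1 u2] := qu t; have vt := vT t (le_trans tb bT).
  have /andP[r0 r1] := div_shift_le _ _ u1 u2.
  have : alpha * e <= alpha * (gamma - (u t).1) by rewrite ler_pM2l//; lra.
  rewrite /prey_growth; lra.
have cub : - (gamma - e) < - (u b).1 by rewrite ltrN2.
have stays t : t <= b -> (u t).1 <= (u b).1.
  move=> tb; rewrite -lerN2; apply: (nonincreasing_backward _ _ _ _ dN _ cub _ tb) => s sb.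
  rewrite ltrN2 => /(grows s sb) g; rewrite oppr_le0 mulr_ge0//; first by case: (qu s).
  by apply: le_trans g; exact: ltW.
have {}grows t : t <= b -> alpha * e / 2 <= prey_growth (u t).
  by move=> tb; apply: grows => //; exact: le_lt_trans (stays t tb) ub.
pose e1 := 1 / (2 * beta).
have e10 : 0 < e1 by rewrite divr_gt0// mulr_gt0.
have [a ab ua] : exists2 a, a <= b & (u a).1 < e1.
  apply: contrapT => no.
  have big t : t <= b -> e1 <= (u t).1.
    by move=> tb; rewrite leNgt; apply/negP => ut; apply: no; exists t.
  have k0 : 0 < e1 * (alpha * e / 2) by exact: mulr_gt0.
  have le0 t : t <= b -> - (u t).1 <= 0 by rewrite oppr_le0 => _; case: (qu t).
  (* any level below - (u b).1 contradicts the linear backward growth *)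
  suff : - (u b).1 <= - (u b).1 - 1 by lra.
  apply: (no_backward_escape _ _ _ _ _ _ k0 dN le0) => t tb _.
  by rewrite lerN2 ler_pM ?(ltW e10) ?(ltW ae) ?big ?grows.
have scarce t : t <= a -> (u t).1 < 1 / (2 * beta).
  move=> ta; apply: le_lt_trans ua; rewrite -lerN2.
  apply: (nonincreasing_backward _ _ a (- (u a).1 - 1) dN) => //; last lra.
  move=> s sa _; rewrite oppr_le0 mulr_ge0//; first by case: (qu s).
  by apply: le_trans (grows s (le_trans sa ab)); exact: ltW.
suff : (u a).2 <= (u a).2 / 2 by have := v0 a; lra.
have k0 : 0 < (u a).2 / 4 by exact: divr_gt0.
apply: (no_backward_escape _ _ a _ _ M k0 (fun s => solves_at_predator _ _ (su s))) => //.
move=> t ta ut; have := ler_wpM2l (qu t).2 (predator_growth_scarce _ (qu t) (scarce t ta)).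
lra.
Qed.

Lemma backward_limit_saddle u M : complete_solution u -> (forall t, 0 < (u t).2) ->
  (forall t, (u t).1 <= M /\ (u t).2 <= M) ->
  (forall e, 0 < e -> exists T, forall t, t <= T -> (u t).1 < e \/ (u t).2 < e) ->
  u t @[t --> -oo] --> (gamma, 0).
Proof.
move=> cu v0 uM leaves.
have vM t : (u t).2 <= M by case: (uM t).
have vlim := predator_vanishes_backward u M cu vM leaves.
have ulim := prey_recovers_backward u M cu v0 vM vlim.
have ug := prey_le_capacity u M cu (fun t => (uM t).1).
have -> : u = fun t => ((u t).1, (u t).2).
  by apply/funext => t; rewrite -surjective_pairing.
have u1 : (u t).1 @[t --> -oo] --> gamma.
  apply/cvgrPdist_le => e e0.
  have [T uT] := ulim e e0; exists T; split; first exact: num_real.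
  by move=> t /ltW /uT uT' /=; rewrite ger0_norm ?subr_ge0 ?ug//; lra.
have u2 : (u t).2 @[t --> -oo] --> (0 : R).
  apply/cvgrPdist_le => e e0.
  have [T vT] := vlim e e0; exists T; split; first exact: num_real.
  by move=> t /ltW /vT vT' /=; rewrite sub0r normrN ger0_norm// ltW.
exact: cvg_pair u1 u2.
Qed.

(** * The flow on the prey axis *)

Context (phi : R -> R * R -> R * R).
Context (hphi : semiflow_of_system alpha beta gamma phi).

(** Near [t] the orbit is a trajectory of the semiflow started at time [t - 1], to
    which the equations apply at the positive time [1]. *)
Lemma complete_orbit_solution A u : A `<=` quadrant -> complete_orbit phi A u ->
  complete_solution u.
Proof.
have [sf sol] := hphi.
move=> Aq [Au uphi]; split => [t|t]; last exact: Aq.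
pose y := u (t - 1); pose w r := phi (r + (1 - t)) y.
have near_w : \forall r \near t, w r = u r.
  have tt : t - 1 < t by rewrite ltrBlDr ltrDl.
  apply: filterS (cvgr_gt t (@cvg_id _ (nbhs t)) _ tt) => r /ltW rt.
  by rewrite /w /y -uphi; [congr u; ring|lra].
have ut : u t = phi (t + (1 - t)) y.
  by rewrite addrCA subrr addr0 /y -uphi ?subrK.
have tpos : 0 < t + (1 - t) by rewrite addrCA subrr addr0.
have [d1 d2] := sol y (Aq _ (Au _)) _ tpos.
rewrite /solves_at ut; split.
- apply: (near_eq_is_derive (f := fun r => (w r).1)).
    by apply: filterS near_w => r ->.
  exact: (is_derive1_shift _ (fun r => prey_rate alpha gamma (phi r y))) d1.
- apply: (near_eq_is_derive (f := fun r => (w r).2)).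
    by apply: filterS near_w => r ->.
  exact: (is_derive1_shift _ (fun r => predator_rate beta (phi r y))) d2.
Qed.

Lemma within_trajectory y (b : R) : quadrant y ->
  {within `[0, b], continuous (fun t => phi t y)}.
Proof.
move=> qy; have [sf _] := hphi.
apply: (within_continuous_comp _ _ _ _ _ _ (fun t : R => (t, y)) (semiflow_continuous sf)).
- move=> t; exact: cvg_pair (@cvg_id _ (nbhs t)) (@cvg_cst _ y _ (nbhs t) _).
- by move=> t; rewrite /= in_itv => /andP[].
Qed.

Lemma within_time_map t (b : R) : 0 <= t ->
  {within `[0, b], continuous (fun y : R => phi t (y, 0))}.
Proof.
move=> t0; have [sf _] := hphi.
apply: (within_continuous_comp _ _ _ _ _ _ (fun y : R => (t, (y, 0 : R))) (semiflow_continuous sf)).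
- move=> y; have y0 : (z, 0 : R) @[z --> y] --> (y, 0 : R).
    exact: cvg_pair (@cvg_id _ (nbhs y)) (@cvg_cst _ (0 : R) _ (nbhs y) _).
  exact: cvg_pair (@cvg_cst _ t _ (nbhs y) _) y0.
- by move=> y; rewrite /= in_itv => /andP[].
Qed.

Lemma phi_quadrant t y : 0 <= t -> quadrant y -> quadrant (phi t y).
Proof. by have [sf _] := hphi; exact: (@semiflow_stable _ _ _ _ sf t y). Qed.

Lemma phi_axis t (y : R) : 0 <= t -> 0 <= y -> (phi t (y, 0)).2 = 0.
Proof.
move=> t0 y0; have [sf sol] := hphi.
have qy : quadrant (y, 0 : R) by [].
have [_ c2] := within_fst_snd _ _ (within_trajectory _ t qy).
apply/(@zero_of_linear R (fun s => (phi s (y, 0)).2)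
  (fun s => predator_growth (phi s (y, 0))) (1 + beta) 0 t t0) => //.
- by rewrite addr_ge0// ltW.
- by move=> s /andP[s0 _]; apply: solves_at_predator; exact: sol.
- move=> s /andP[/ltW s0 _]; apply: predator_growth_norm => //; exact: phi_quadrant.
- by rewrite (semiflow0 sf).
Qed.

(** On the axis [[0, gamma] x {0}] both end points are equilibria, so each time map
    is onto by the intermediate value theorem. *)
Lemma axis_backward x t : 0 <= t -> (`[0, gamma] `*` [set 0]) x ->
  exists2 y, (`[0, gamma] `*` [set 0]) y & phi t y = x.
Proof.
case: x => x1 x2 t0 [/=]; rewrite in_itv /= => /andP[x10 x1g] ->.
have [sf sol] := hphi.
pose f y := (phi t (y, 0)).1.
have g0 := gamma_gt0.
have trajectory y : 0 <= y -> [/\ {within `[0, t], continuous (fun s => (phi s (y, 0)).1)},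
    (forall s, 0 < s < t -> is_derive s 1 (fun s => (phi s (y, 0)).1)
       ((phi s (y, 0)).1 * (alpha * (gamma - (phi s (y, 0)).1)))),
    (forall s, 0 <= s -> 0 <= (phi s (y, 0)).1) & (phi 0 (y, 0)).1 = y].
  move=> y0; have qy : quadrant (y, 0 : R) by [].
  split.
  - by have [] := within_fst_snd _ _ (within_trajectory _ t qy).
  - move=> s /andP[s0 _].
    have := solves_at_prey _ _ (sol _ qy s s0).
    by rewrite /prey_growth phi_axis ?(ltW s0)// mul0r subr0.
  - by move=> s s0; case: (phi_quadrant s _ s0 qy).
  - by rewrite (semiflow0 sf).
have f0 : f 0 = 0.
  have [c d p z] := trajectory 0 (lexx 0).
  apply/eqP; rewrite eq_le p// andbT.
  have : f 0 <= (phi 0 (0, 0)).1 * expR (alpha * gamma * (t - 0)).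
    apply: (gronwall _ _ _ _ _ t0 d c) => s /andP[s0 _].
    have U0 := p s (ltW s0).
    have : 0 <= alpha * ((phi s (0, 0)).1 ^+ 2) by rewrite mulr_ge0 ?sqr_ge0// ltW.
    lra.
  by rewrite z mul0r.
have fg : f gamma = gamma.
  have [c d p z] := trajectory gamma (ltW g0).
  pose D s := ((phi s (gamma, 0)).1 - gamma) * ((phi s (gamma, 0)).1 - gamma).
  have : D t <= D 0 * expR (0 * (t - 0)).
    apply: (gronwall D (fun s => - 2 * alpha * (phi s (gamma, 0)).1 * D s)) => //.
    - move=> s st; have ds := d s st.
      have dx : is_derive s 1 (fun s => (phi s (gamma, 0)).1 - gamma)
         ((phi s (gamma, 0)).1 * (alpha * (gamma - (phi s (gamma, 0)).1))).
        by apply: is_derive_eq; rewrite subr0.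
      have := is_deriveM dx dx.
      by move=> /is_derive_eq; apply; rewrite /GRing.scale /D /=; ring.
    - move/subspace_continuousP: c => c; apply/subspace_continuousP => s /c cs.
      have cx : (phi r (gamma, 0)).1 - gamma @[r --> within `[0, t] (nbhs s)]
          --> (phi s (gamma, 0)).1 - gamma.
        by apply: cvgB; [exact: cs|exact: cvg_cst].
      by apply: cvgM; exact: cx.
    - move=> s /andP[s0 _]; rewrite mul0r.
      have D0 : 0 <= D s by rewrite /D -expr2 sqr_ge0.
      have : 0 <= alpha * (phi s (gamma, 0)).1 * D s by rewrite mulr_ge0// mulr_ge0 ?p ?(ltW s0)// ltW.
      lra.
  rewrite /D z subrr !mul0r -expr2 => le0.
  have : ((phi t (gamma, 0)).1 - gamma) ^+ 2 == 0 by rewrite eq_le le0 sqr_ge0.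
  by rewrite sqrf_eq0 subr_eq0 => /eqP.
have [cf _] := within_fst_snd _ _ (within_time_map t gamma t0).
have [|y] := @IVT R f 0 gamma x1 (ltW g0) cf.
  by rewrite f0 fg ge_min x10 le_max x1g orbT.
rewrite in_itv /= => /andP[y0 yg] fy.
exists (y, 0); first by split => //=; rewrite in_itv /= y0.
by rewrite [LHS]surjective_pairing phi_axis// -/(f y) fy.
Qed.

(** * Structure of the two attractors *)

Context (A Aint : set (R * R)).
Context (hA : global_attractor phi quadrant A).
Context (hAint : global_attractor phi int_quadrant Aint).

Lemma axis_compact : compact (`[0, gamma] `*` [set 0] : set (R * R)).
Proof. by apply: compact_setX; [exact: segment_compact|exact: compact_set1]. Qed.

Lemma axis_sub_attractor : `[0, gamma] `*` [set 0] `<=` A.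
Proof.
apply: (subset_attractor phi quadrant A _ hA _ axis_compact).
  by move=> [x1 x2] [/=]; rewrite in_itv /= => /andP[? _] ->; split.
by move=> t x; exact: axis_backward.
Qed.

Lemma interior_attractor_sub : Aint `<=` A.
Proof.
have [Ai cAi _ invAi _] := hAint.
apply: (subset_attractor phi quadrant A _ hA _ cAi).
  exact: subset_trans Ai (@int_quadrantW R).
move=> t x t0; rewrite -{1}(invAi t t0) => -[y Ay yx].
by exists y.
Qed.

Lemma interior_attractor_nonempty : Aint !=set0.
Proof.
have [_ _ _ _ attAi] := hAint.
have c1 : compact [set ((1, 1) : R * R)] by exact: compact_set1.
have s1 : [set ((1, 1) : R * R)] `<=` int_quadrant by move=> x ->; split; exact: ltr01.
have [T [T0 att]] := attAi _ s1 c1 1 ltr01.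
by have [a Aa _] := att T (1, 1) (lexx T) erefl; exists a.
Qed.

(** A point of the interior attractor has a complete orbit inside it, and complete
    solutions are determined by one value, in the past as well. *)
Lemma complete_orbit_in_interior_attractor u B : B `<=` quadrant ->
  complete_orbit phi B u -> forall s t, Aint (u s) -> Aint (u t).
Proof.
move=> Bq ou s t us; have [Ai _ _ invAi _] := hAint; have [sf _] := hphi.
have Aiq := subset_trans Ai (@int_quadrantW R).
have [w ow w0] := complete_orbit_through phi quadrant Aint (u s) sf Aiq invAi us.
have cu := complete_orbit_solution B u Bq ou.
have cw := complete_orbit_solution Aint w Aiq ow.
have cw' := complete_solution_shift _ (- s) cw.
rewrite (complete_solution_unique _ _ cu cw' s t).
  by case: ow.
by rewrite subrr w0.
Qed.

(** If the orbit kept returning, ever further in the past, to the square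
    [[e, M] x [e, M]], then [u t0] would be reached from this compact set after
    arbitrarily long times, hence lie in the interior attractor. *)
Lemma leaves_compacts_backward u M t0 : complete_orbit phi A u ->
  (forall t, (u t).1 <= M /\ (u t).2 <= M) -> ~ Aint (u t0) ->
  forall e, 0 < e -> exists T, forall t, t <= T -> (u t).1 < e \/ (u t).2 < e.
Proof.
move=> [Au uphi] uM nAi e e0; apply: contrapT => no.
have [Ai cAi _ _ attAi] := hAint.
pose K := `[e, M] `*` `[e, M] : set (R * R).
have cK : compact K by apply: compact_setX; exact: segment_compact.
have KS : K `<=` int_quadrant.
  move=> x [/=]; rewrite !in_itv /= => /andP[x1 _] /andP[x2 _].
  by split; exact: lt_le_trans e0 _.
apply: nAi; apply: (attracted_mem phi Aint K _ (closed_of_compact _ cAi) (attAi K KS cK)) => T.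
have [s [sT us]] : exists s, s <= t0 - Num.max T 0 /\ K (u s).
  apply: contrapT => nK; apply: no; exists (t0 - Num.max T 0) => s sT.
  have [|us1] := ltP (u s).1 e; first by left.
  have [|us2] := ltP (u s).2 e; first by right.
  exfalso; apply: nK; exists s; split => //; have [M1 M2] := uM s.
  by split => /=; rewrite in_itv /=; apply/andP.
have : Num.max T 0 <= t0 - s by lra.
rewrite ge_max => /andP[Ts s0].
by exists (t0 - s), (u s); rewrite -uphi// (addrC s) subrK.
Qed.

(** Both axes are invariant in both time directions.  On the predator axis
    nonzero solutions are unbounded backward, and on the prey axis those in the
    attractor stay in [[0, gamma]]. *)
Lemma attractor_off_axis u M : complete_orbit phi A u ->
  (forall t, (u t).1 <= M /\ (u t).2 <= M) ->
  ~ (`[0, gamma] `*` [set 0]) (u 0) -> forall t, int_quadrant (u t).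
Proof.
move=> ou uM nax; have [Aq _ _ _ _] := hA.
have cu := complete_orbit_solution A u Aq ou; have [su qu] := cu.
have V0 : (u 0).2 != 0.
  apply/eqP => u20; apply: nax; split => //=; rewrite in_itv /=.
  rewrite (prey_le_capacity _ _ cu (fun t => (uM t).1)) andbT.
  by case: (qu 0).
have U0 : (u 0).1 != 0.
  apply/eqP => u10.
  have Uz := prey_zero _ _ cu uM 0 ^~ u10.
  have V0' : 0 < (u 0).2 by rewrite lt_neqAle eq_sym V0; case: (qu 0).
  suff : (u 0).2 <= (u 0).2 / 2 by lra.
  have k0 : 0 < (u 0).2 / 2 by exact: divr_gt0.
  apply: (no_backward_escape _ _ 0 _ _ M k0 (fun s => solves_at_predator _ _ (su s))).
    by move=> t _; case: (uM t).
  by move=> t _ Vt; rewrite /predator_growth Uz mul0r mulr0 sub0r mulrN1 lerN2 ltW.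
move=> t; have [u1 u2] := qu t; split; rewrite lt_neqAle eq_sym.
- rewrite u1 andbT; apply: contra U0 => /eqP ut; apply/eqP.
  exact: (prey_zero _ _ cu uM t 0 ut).
- rewrite u2 andbT; apply: contra V0 => /eqP ut; apply/eqP.
  exact: (predator_zero _ cu t 0 ut).
Qed.

Lemma connecting_orbit x : A x -> ~ (`[0, gamma] `*` [set 0]) x -> ~ Aint x ->
  exists u, [/\ u 0 = x, complete_orbit phi A u, complete_solution u,
    forall t, int_quadrant (u t) & u t @[t --> -oo] --> (gamma, 0)].
Proof.
move=> Ax nax nAi; have [Aq cA _ invA _] := hA; have [sf _] := hphi.
have [u ou u0] := complete_orbit_through phi quadrant A x sf Aq invA Ax.
have [M AM] := compact_coordinates_bounded A cA.
have uM t : (u t).1 <= M /\ (u t).2 <= M by apply: AM; case: ou.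
have cu := complete_orbit_solution A u Aq ou.
have ui t : int_quadrant (u t).
  by apply: (attractor_off_axis u M ou uM); rewrite u0.
exists u; split => //.
apply: (backward_limit_saddle u M cu) => //.
  by move=> t; case: (ui t).
by apply: (leaves_compacts_backward u M 0 ou uM); rewrite u0.
Qed.

(** Otherwise two disjoint nonempty closed sets would cover the connected
    attractor. *)
Lemma attractor_neq_axis_interior : exists x,
  [/\ A x, ~ (`[0, gamma] `*` [set 0]) x & ~ Aint x].
Proof.
have [_ _ conA _ _] := hA; have [Ai cAi _ _ _] := hAint.
apply: contrapT => no.
pose E (b : bool) : set (R * R) := if b then Aint else `[0, gamma] `*` [set 0].
apply: ((connectedP A).1 conA E); split.
- case; first exact: interior_attractor_nonempty.
  by exists (0, 0); split => //=; rewrite in_itv /= lexx ltW.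
- rewrite eqEsubset; split => [x Ax|x [/axis_sub_attractor//|/interior_attractor_sub//]].
  apply: contrapT => nE; apply: no; exists x; split => // Ex; apply: nE; [left|right]; exact: Ex.
- have disj : (`[0, gamma] `*` [set 0]) `&` Aint = set0.
    by rewrite -subset0 => x [[_ x2] /Ai[_]]; rewrite x2 ltxx.
  have clos (B : set (R * R)) : compact B -> closure B = B.
    by move=> /closed_of_compact /closure_id.
  by split; rewrite clos //; exact: axis_compact.
Qed.

(** Limit points lie in the interior attractor since it attracts [u 0], and the
    orbit cannot enter its interior. *)
Lemma omega_limit_sub_boundary u : complete_orbit phi A u -> int_quadrant (u 0) ->
  (forall t, ~ Aint (u t)) -> omega_limit u `<=` boundary Aint.
Proof.
have [_ cAi _ _ attAi] := hAint.
move=> [_ uphi] u0 nAu p pu; split; last first.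
  move=> pAi; have Fu : (u t @[t --> +oo]) (range u).
    by exists 0; split; [exact: num_real|move=> t _; exists t].
  by have [q [[t _ <-] /nAu]] := pu _ _ Fu pAi.
suff : Aint p by exact: subset_closure.
apply: (closed_of_compact _ cAi) => B pB; have [e /= e0 eB] := (nbhs_ballP p B).1 pB.
have xi : [set u 0] `<=` int_quadrant by move=> y ->.
have cx : compact [set u 0] by exact: compact_set1.
have e20 : 0 < e / 2 by exact: divr_gt0.
have [T [T0 att]] := attAi _ xi cx _ e20.
have Fu : (u t @[t --> +oo]) (u @` [set t | T <= t]).
  by exists T; split; [exact: num_real|move=> t /ltW Tt; exists t].
have [q [[s Ts <-] pus]] := pu _ _ Fu (nbhsx_ballx p _ e20).
have [a Aa aus] := att s (u 0) Ts erefl.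
exists a; split => //; apply: eB; apply: (ball_split (z := u s)) => //.
by apply: ball_sym; rewrite -(add0r s) uphi//; exact: le_trans Ts.
Qed.

End PredatorPrey.

Theorem theorem2p12 (R : realType) (alpha beta gamma : R)
    (alpha_gt0 : 0 < alpha) (beta_gt0 : 0 < beta) (gamma_gt0 : 0 < gamma)
    (hgb : 1 < gamma * (beta - 1))
    (phi : R -> R * R -> R * R)
    (hphi : semiflow_of_system alpha beta gamma phi)
    (A Aint : set (R * R))
    (hA : global_attractor phi quadrant A)
    (hAint : global_attractor phi int_quadrant Aint) :
  exists u : R -> R * R,
    [/\ heteroclinic alpha beta gamma (gamma, 0) Aint (boundary Aint) u,
        forall v : R -> R * R,
          heteroclinic alpha beta gamma (gamma, 0) Aint (boundary Aint) v ->
          exists tau : R, forall t : R, v t = u (t + tau),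
        A = (`[0, gamma] `*` [set 0]) `|` range u `|` Aint
      & [/\ (`[0, gamma] `*` [set 0]) `&` range u = set0,
            (`[0, gamma] `*` [set 0]) `&` Aint = set0
          & range u `&` Aint = set0]].
Proof.
have [Aq _ _ _ _] := hA; have [Ai _ _ _ _] := hAint.
have [x [Ax nax nAi]] := attractor_neq_axis_interior _ _ _
  alpha_gt0 beta_gt0 gamma_gt0 phi hphi _ _ hA hAint.
have connect := connecting_orbit _ _ _
  alpha_gt0 beta_gt0 gamma_gt0 phi hphi _ _ hA hAint.
have [u [u0 ou cu ui ulim]] := connect x Ax nax nAi.
have nAu t : ~ Aint (u t).
  move=> ut; apply: nAi; rewrite -u0.
  exact: (complete_orbit_in_interior_attractor _ _ _
    alpha_gt0 beta_gt0 gamma_gt0 phi hphi _ hAint _ _ Aq ou t 0 ut).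
have positive (w : R -> R * R) : (forall t, int_quadrant (w t)) -> forall t, 0 < (w t).2.
  by move=> wi t; case: (wi t).
exists u; split.
- split => //; first by case: cu.
    by move=> /(_ (u 0)) uA; apply: (nAu 0); apply: uA; exists 0.
  by apply: (omega_limit_sub_boundary phi A Aint hAint u ou _ nAu).
- move=> v [sv vi _ vlim _].
  apply: (emanating_solution_unique _ _ _ alpha_gt0 beta_gt0 gamma_gt0 hgb) => //.
  + by split => // t; have [? ?] := vi t; split; exact: ltW.
  + exact: positive.
  + exact: positive.
- rewrite eqEsubset; split => [y Ay|y [[]|]].
  + have [ay|nay] := pselect ((`[0, gamma] `*` [set 0]) y); first by left; left.
    have [iy|niy] := pselect (Aint y); first by right.
    have [w [w0 _ cw wi wlim]] := connect y Ay nay niy.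
    have [tau wu] : exists tau, forall t, w t = u (t + tau).
      apply: (emanating_solution_unique _ _ _ alpha_gt0 beta_gt0 gamma_gt0 hgb) => //;
        exact: positive.
    by left; right; exists (0 + tau) => //; rewrite -wu.
  + exact: (axis_sub_attractor _ _ _ alpha_gt0 beta_gt0 gamma_gt0 phi hphi _ hA).
  + by move=> [t _ <-]; case: ou.
  + exact: (interior_attractor_sub phi _ _ hA hAint).
- split; rewrite -subset0 => y.
  + by move=> [[_ y2] [t _ uty]]; have [_] := ui t; rewrite uty y2 ltxx.
  + by move=> [[_ y2] /Ai[_]]; rewrite y2 ltxx.
  + by move=> [[t _ <-] /nAu].
Qed.
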